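(* Let $\alpha_1>0\ge\alpha_2$, $\kappa>0$, $\gamma=\omega_1-\omega_2>0$, $a=\alpha_1-\alpha_2$, and consider $$\dot z_1=(\alpha_1+\mathrm{i}\omega_1-|z_1|^2)z_1+\tfrac{\kappa}{2}(z_2-z_1),\qquad \dot z_2=(\alpha_2+\mathrm{i}\omega_2-|z_2|^2)z_2+\tfrac{\kappa}{2}(z_1-z_2).$$ Let $$f=\alpha_1+\alpha_2-\kappa+\sqrt{\tfrac12\Big(\sqrt{4a^2\gamma^2+(a^2-\gamma^2+\kappa^2)^2}+a^2-\gamma^2+\kappa^2\Big)}.$$ If $f>0$, then there exists a unique linearly stable Active Phase-Locked state $(l_\infty,R_\infty,\Phi_\infty)$ in the region $$l_\infty\in(0,a),\qquad R_\infty\in(R_\infty^-,R_\infty^+),\qquad \Phi_\infty\in(0,\tfrac{\pi}{2}),$$ where $$R_\infty^-=\begin{cases}1,&\kappa\ge\gamma,\\ \frac{\gamma}{\kappa}+\frac1\kappa\sqrt{\gamma^2-\kappa^2},&\kappa<\gamma,\end{cases}\qquad R_\infty^+=\begin{cases}\infty,&\kappa\le2\alpha_1,\\ \sqrt{\frac{\kappa-2\alpha_2}{\kappa-2\alpha_1}},&\kappa>2\alpha_1.\end{cases}$$ If $f<0$, then the Amplitude Death Phase-Locked state $r_1=r_2=0$, $Z=Y_\infty^+=\frac{1}{\kappa}\big(a+\mathrm{i}\gamma+\sqrt{(a+\mathrm{i}\gamma)^2+\kappa^2}\big)$ is stable.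
   Context: Write $z_j=r_je^{\mathrm{i}\phi_j}$, $R=r_1/r_2$, $\Phi=\phi_1-\phi_2$, $l=r_1^2-r_2^2$, $Z=z_1/z_2=Re^{\mathrm{i}\Phi}$. With $R>1$, $l>0$ one has $r_1^2=\frac{lR^2}{R^2-1}$, $r_2^2=\frac{l}{R^2-1}$, and the relative dynamics is the closed system $$\dot R=(a-l)R+\tfrac{\kappa}{2}\cos(\Phi)(1-R^2),\quad \dot\Phi=\gamma-\tfrac{\kappa}{2}\big(R+\tfrac1R\big)\sin\Phi,$$ $$\dot l=\tfrac{2l}{R^2-1}\big(\alpha_1R^2-\alpha_2-l(R^2+1)\big)-\kappa l.$$ An Active Phase-Locked state is an equilibrium $(l_\infty,R_\infty,\Phi_\infty)$ of this system with $r_1,r_2>0$; it is linearly stable if all eigenvalues of the Jacobian there have negative real part. The Amplitude Death Phase-Locked state is viewed as the equilibrium $(r_1,r_2,Z)=(0,0,Y_\infty^+)$ of $$\dot r_1=\big(\alpha_1+\tfrac{\kappa}{2}(\mathrm{Re}(1/Z)-1)-r_1^2\big)r_1,\quad \dot r_2=\big(\alpha_2+\tfrac{\kappa}{2}(\mathrm{Re}(Z)-1)-r_2^2\big)r_2,$$ $$\dot Z=(a+\mathrm{i}\gamma-r_1^2+r_2^2)Z+\tfrac{\kappa}{2}(1-Z^2).$$ The complex square root is the principal one (positive real part). *)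

(* Defs.v *)
From mathcomp Require Import all_boot all_order all_algebra.
From mathcomp Require Import all_classical all_reals all_analysis.
From mathcomp Require Import complex.

Set Implicit Arguments.
Unset Strict Implicit.
Unset Printing Implicit Defensive.

Import Order.TTheory GRing.Theory Num.Theory.
Import numFieldNormedType.Exports.

Local Open Scope ring_scope.
Local Open Scope complex_scope.

(* Autonomous systems x' = F x on R^n, points being row vectors. *)

Definition equilibrium (R : realType) n (F : 'rV[R]_n -> 'rV[R]_n)
  (x : 'rV[R]_n) : Prop := F x = 0.

(* [jacobian F x] acts on row vectors from the right, so it is the transpose of
   the usual matrix of partial derivatives; the eigenvalues are the same. If F
   is not differentiable at x it is the zero matrix, which is not stable. *)
Definition linearly_stable (R : realType) n (F : 'rV[R]_n -> 'rV[R]_n)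
    (x : 'rV[R]_n) : Prop :=
  forall z : R[i],
    eigenvalue (map_mx (real_complex R) (jacobian F x)) z -> complex.Re z < 0.

(* Relative dynamics, in the coordinates (l, rho, Phi) with
   l = r1^2 - r2^2, rho = r1 / r2 and Phi = phi1 - phi2. The formulas are
   meaningful for rho > 1 only (division by rho^2 - 1). *)
Definition relative_field (R : realType) (alpha1 alpha2 kappa gamma : R)
    (x : 'rV[R]_3) : 'rV[R]_3 :=
  let a := alpha1 - alpha2 in
  let l := x 0 0 in
  let rho := x 0 1 in
  let Phi := x 0 2 in
  \row_(i < 3)
    [:: 2 * l / (rho ^+ 2 - 1)
          * (alpha1 * rho ^+ 2 - alpha2 - l * (rho ^+ 2 + 1)) - kappa * l;
        (a - l) * rho + kappa / 2 * cos Phi * (1 - rho ^+ 2);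
        gamma - kappa / 2 * (rho + rho^-1) * sin Phi]`_i.

Definition active_phase_locked (R : realType) (alpha1 alpha2 kappa gamma : R)
    (x : 'rV[R]_3) : Prop :=
  [/\ 0 < x 0 0, 1 < x 0 1,
      exists r1 r2 : R, [/\ 0 < r1, 0 < r2,
        x 0 0 = r1 ^+ 2 - r2 ^+ 2 & x 0 1 = r1 / r2]
    & equilibrium (relative_field alpha1 alpha2 kappa gamma) x].

Definition Rinf_minus (R : realType) (kappa gamma : R) : R :=
  if gamma <= kappa then 1
  else gamma / kappa + kappa^-1 * Num.sqrt (gamma ^+ 2 - kappa ^+ 2).

Definition Rinf_plus (R : realType) (alpha1 alpha2 kappa : R) : \bar R :=
  if kappa <= 2 * alpha1 then +oo%E
  else (Num.sqrt ((kappa - 2 * alpha2) / (kappa - 2 * alpha1)))%:E.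

(* Dynamics of (r1, r2, Z), Z = z1 / z2, in the real coordinates
   (r1, r2, Re Z, Im Z); meaningful for Z <> 0 only. *)
Definition death_coords (R : realType) (r1 r2 : R) (Z : R[i]) : 'rV[R]_4 :=
  \row_(i < 4) [:: r1; r2; complex.Re Z; complex.Im Z]`_i.

Definition death_field (R : realType) (alpha1 alpha2 kappa gamma : R)
    (x : 'rV[R]_4) : 'rV[R]_4 :=
  let a := alpha1 - alpha2 in
  let r1 := x 0 0 in
  let r2 := x 0 1 in
  let Z : R[i] := x 0 2 +i* x 0 3 in
  death_coords
    ((alpha1 + kappa / 2 * (complex.Re Z^-1 - 1) - r1 ^+ 2) * r1)
    ((alpha2 + kappa / 2 * (complex.Re Z - 1) - r2 ^+ 2) * r2)
    (((a +i* gamma) - (r1 ^+ 2)%:C + (r2 ^+ 2)%:C) * Z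
      + (kappa / 2)%:C * (1 - Z ^+ 2)).

(* [sqrtc] is the principal square root: its real part is nonnegative. *)
Definition Yinf_plus (R : realType) (a kappa gamma : R) : R[i] :=
  (kappa^-1)%:C
    * ((a +i* gamma) + sqrtc ((a +i* gamma) ^+ 2 + (kappa ^+ 2)%:C)).

(* Main.v *)
(** With k = kappa / 2 and u = R^2, the three equilibrium equations express
    l, cos Phi and sin Phi as functions of u, and cos^2 + sin^2 = 1 becomes a
    polynomial equation in u. It has exactly one root in (1, oo), by a
    monotonicity argument, and f > 0 makes the polynomial negative at the value
    of u where l vanishes (if there is one), so that the root has l > 0. The
    bounds l < a, R > R^- and cos Phi > 0 are then automatic. The characteristic
    polynomial at the equilibrium has the shape
      (z + p) ((z + m)^2 + n w) + q r (z + m)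
    with p, m > 0, n w >= 0 and q r > - p m, so the Routh-Hurwitz criterion
    applies. At the amplitude death state the Jacobian is block diagonal with
    eigenvalues f / 2 (twice) and the two conjugates of
    - sqrt ((a + i gamma)^2 + kappa^2). *)
Require Import Defs.
From mathcomp Require Import all_boot all_order all_algebra.
From mathcomp Require Import all_classical all_reals all_analysis.
From mathcomp Require Import complex polyrcf ring lra.
Import Order.TTheory GRing.Theory Num.Theory.
Import numFieldNormedType.Exports.
Local Open Scope ring_scope.

Set Implicit Arguments.
Unset Strict Implicit.
Unset Printing Implicit Defensive.

(** * Differentials of explicit scalar formulas, and Jacobians by coordinates *)

Section PointwiseDifferentials.
Variables (R : realType) (V : normedModType R).
Implicit Types (f g df dg : V -> R) (x : V).

(** The rules of this section are stated for [fun y => ...], so that [differentiate] can apply them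
    syntactically to an expanded formula. *)
Lemma is_diff_const (c : R) x : is_diff x (fun=> c) (fun=> 0).
Proof. exact: is_diff_cst. Qed.

Lemma is_diff_add f g df dg x : is_diff x f df -> is_diff x g dg ->
  is_diff x (fun y => f y + g y) (fun v => df v + dg v).
Proof. by move=> hf hg; exact: is_diffD. Qed.

Lemma is_diff_opp f df x : is_diff x f df ->
  is_diff x (fun y => - f y) (fun v => - df v).
Proof. by move=> hf; exact: is_diffN. Qed.

Lemma is_diff_mul f g df dg x : is_diff x f df -> is_diff x g dg ->
  is_diff x (fun y => f y * g y) (fun v => f x * dg v + g x * df v).
Proof. by move=> hf hg; exact: is_diffM. Qed.

Lemma is_diff_sqr f df x : is_diff x f df ->
  is_diff x (fun y => f y ^+ 2) (fun v => 2 * f x * df v).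
Proof.
move=> hf; have h : is_diff x (fun y => f y ^+ 2) _ := is_diff_mul hf hf.
apply: is_diff_eq; apply/funext => v; ring.
Qed.

Lemma is_diff_inv f df x : f x != 0 -> is_diff x f df ->
  is_diff x (fun y => (f y)^-1) (fun v => - (f x) ^- 2 * df v).
Proof.
move=> fx0 hf; have hd : differentiable f x by exact: ex_diff.
apply: DiffDef; first exact: differentiableV.
by rewrite diffV // diff_val.
Qed.

Lemma is_diff_comp1 (h : R -> R) (dh : R) f df x :
  is_derive (f x) 1 h dh -> is_diff x f df ->
  is_diff x (fun y => h (f y)) (fun v => df v * dh).
Proof.
move=> hh hf.
have hd : differentiable h (f x) by apply/derivable1_diffP; exact: ex_derive.
have hdiff : is_diff (f x) h (fun v => v * dh).
  apply: DiffDef => //; rewrite diff1E // derive1E derive_val.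
  exact/funext.
exact: (is_diff_comp hf hdiff).
Qed.

Lemma is_diff_coord n m (M : 'M[R]_(n, m)) i j :
  is_diff M (fun N : 'M[R]_(n, m) => N i j) (fun v => v i j).
Proof.
apply: DiffDef; first exact: differentiable_coord.
have @f : {linear 'M[R]_(n, m) -> R}.
  by exists (fun N : 'M[R]_(_, _) => N i j); do 2![eexists]; do ?[constructor];
     rewrite ?mxE// => ? *; rewrite ?mxE//; move=> ?; rewrite !mxE.
rewrite (_ : (fun N : 'M[R]_(n, m) => N i j) = f) //.
by rewrite diff_lin //; exact: coord_continuous.
Qed.

End PointwiseDifferentials.

(** [F] is the sum of its coordinates times the unit row vectors, hence differentiable; composing
    with a coordinate map then identifies each entry. *)
Lemma jacobian_rows (R : realType) n m (F : 'rV[R]_n -> 'rV[R]_m) x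
    (dF : 'I_m -> 'rV[R]_n -> R) :
    (forall j, is_diff x (fun y => F y 0 j) (dF j)) ->
  jacobian F x = \matrix_(i, j) dF j (delta_mx 0 i).
Proof.
move=> hF.
have dF' : differentiable F x.
  have -> : F = \sum_(j < m) (fun y => F y 0 j *: delta_mx 0 j).
    apply/funext => y; by rewrite fct_sumE; exact: row_sum_delta.
  apply: differentiable_sum => j; apply: differentiableZl; exact: ex_diff.
apply/matrixP => i j; rewrite !mxE.
have hd := is_diff_comp (differentiableP dF') (is_diff_coord (F x) 0 j).
have := hF j; have -> : (fun y => F y 0 j) = (fun N : 'rV_m => N 0 j) \o F by [].
by move=> h; rewrite -(@diff_val _ _ _ _ _ _ _ h) (@diff_val _ _ _ _ _ _ _ hd).
Qed.

(** * A Routh-Hurwitz criterion for tridiagonal 3 x 3 systems *)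

Section Hurwitz.
Local Open Scope complex_scope.

(** For a root [x + i y] with [x >= 0], the real part of the equation has terms of one sign and a
    nonzero constant term: [C] if [y = 0], and [C - A * B] after elimination of [y^2] otherwise. *)
Lemma hurwitz_cubic (R : realType) (A B C : R) (z : R[i]) :
    0 < A -> 0 < C -> C < A * B ->
    z ^+ 3 + (A%:C * z ^+ 2 + (B%:C * z + C%:C)) = 0 -> complex.Re z < 0.
Proof.
move=> A0 C0 CAB; case: z => x y /=.
rewrite !exprS expr0 mulr1; simpc => /eqP; rewrite eq_complex /=.
move=> /andP[/eqP hre /eqP him]; rewrite ltNge; apply/negP => x0.
have B0 : 0 < B by rewrite -(pmulr_rgt0 _ A0); lra.
have [y0|yN0] := eqVneq y 0.
  move: hre; rewrite y0.
  have : 0 <= x * (x * x) by rewrite !mulr_ge0.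
  have : 0 <= A * (x * x) by rewrite !mulr_ge0 // ltW.
  have : 0 <= B * x by rewrite !mulr_ge0 // ltW.
  lra.
(* The imaginary part determines y^2, and the real part then becomes minus the
   cubic 8 x^3 + 8 A x^2 + 2 (A^2 + B) x + (A B - C). *)
have hy : y * y = 3 * x * x + 2 * A * x + B.
  apply: (mulfI yN0); nra.
have : - 8 * (x * (x * x)) - 8 * (A * (x * x)) - 2 * (A * (A * x)) - 2 * (B * x)
   - (A * B - C) = 0.
  have -> : C = - ((x * (x * x - y * y) - y * (x * y + y * x)) + (A * (x * x - y * y) + B * x)) by lra.
  have -> : y * (x * y + y * x) = 2 * x * (y * y) by ring.
  rewrite hy; ring.
have : 0 <= x * (x * x) by rewrite !mulr_ge0.
have : 0 <= A * (x * x) by rewrite !mulr_ge0 // ltW.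
have : 0 <= B * x by rewrite !mulr_ge0 // ltW.
have : 0 <= A * (A * x) by rewrite !mulr_ge0 // ltW.
lra.
Qed.

(** Eigenvector coordinates replace a determinant. If [v1 = 0], then [z] is [- p] or [- m];
    otherwise eliminating [v0] and [v2] leaves the characteristic polynomial times [v1]. *)
Lemma stable_eigenvector3 (R : realType) (p m q r n w : R) (z v0 v1 v2 : R[i]) :
    0 < p -> 0 < m -> 0 <= n * w -> - (p * m) < q * r ->
    - p%:C * v0 + q%:C * v1 = z * v0 ->
    - r%:C * v0 - m%:C * v1 + n%:C * v2 = z * v1 ->
    - w%:C * v1 - m%:C * v2 = z * v2 ->
    [|| v0 != 0, v1 != 0 | v2 != 0] -> complex.Re z < 0.
Proof.
move=> p0 m0 nw0 qr e0 e1 e2 v_neq0.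
have f0 : (z + p%:C) * v0 = q%:C * v1 by rewrite mulrDl -e0; ring.
have f2 : (z + m%:C) * v2 = - w%:C * v1 by rewrite mulrDl -e2; ring.
have hzN (c : R) v : 0 < c -> v != 0 -> (z + c%:C) * v = 0 -> complex.Re z < 0.
  move=> c0 vN0 /eqP; rewrite mulf_eq0 (negbTE vN0) orbF addr_eq0 => /eqP ->.
  by rewrite -rmorphN /= oppr_lt0.
have [v10|v1N0] := eqVneq v1 0.
  move: v_neq0 f0 f2; rewrite v10 eqxx !mulr0 /= => /orP[] h ? ?; first exact: (hzN p v0).
  exact: (hzN m v2).
have hP : (z + p%:C) * ((z + m%:C) ^+ 2 + (n * w)%:C) + (q * r)%:C * (z + m%:C) = 0.
  apply: (mulfI v1N0); rewrite mulr0 !rmorphM /=.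
  have -> : v1 * ((z + p%:C) * ((z + m%:C) ^+ 2 + n%:C * w%:C)
       + q%:C * r%:C * (z + m%:C)) =
     (z + p%:C) * (z + m%:C) * (z * v1 + m%:C * v1) - (z + p%:C) * n%:C * (- w%:C * v1)
     + (z + m%:C) * r%:C * (q%:C * v1) by ring.
  rewrite -e1 -f0 -f2; ring.
have pm0 : 0 < p * m by rewrite mulr_gt0.
(* Coefficients of the expanded [hP]. Both the constant term and the Hurwitz determinant are a
   positive multiple of [p * m + q * r] plus nonnegative terms. *)
apply: (@hurwitz_cubic R (p + 2 * m) (m ^+ 2 + n * w + 2 * p * m + q * r)
   (p * (m ^+ 2 + n * w) + q * r * m)).
- lra.
- have -> : p * (m ^+ 2 + n * w) + q * r * m = m * (p * m + q * r) + p * (n * w) by ring.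
  have : 0 < m * (p * m + q * r) by apply: mulr_gt0 => //; lra.
  have : 0 <= p * (n * w) by rewrite mulr_ge0 // ltW.
  lra.
- rewrite -subr_gt0.
  have -> : (p + 2 * m) * (m ^+ 2 + n * w + 2 * p * m + q * r)
     - (p * (m ^+ 2 + n * w) + q * r * m)
    = (p + m) * (p * m + q * r) + (p * m * (p + 3 * m)
       + 2 * (m * m ^+ 2) + 2 * (m * (n * w))) by ring.
  have : 0 < (p + m) * (p * m + q * r) by rewrite mulr_gt0 //; lra.
  have : 0 < p * m * (p + 3 * m) by rewrite mulr_gt0 //; lra.
  have : 0 < m * m ^+ 2 by rewrite mulr_gt0 // exprn_gt0.
  have : 0 <= m * (n * w) by rewrite mulr_ge0 // ltW.
  lra.
- rewrite -[RHS]hP !(rmorphD, rmorphM, rmorphXn, rmorph_nat) /=; ring.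
Qed.

End Hurwitz.

(** * The polynomial equation for R^2 and its root *)

(* cos^2 + sin^2 = 1 in the variable u = R^2, with denominators cleared; k stands
   for kappa / 2. *)
Definition phase_poly (R : realType) (a1 a2 k g : R) : {poly R} :=
  'X * (a1%:P - a2 *: 'X + k *: ('X - 1)) ^+ 2 + g ^+ 2 *: ('X * ('X - 1) ^+ 2)
  - k ^+ 2 *: (('X + 1) ^+ 2 * ('X - 1) ^+ 2).

Lemma phase_polyE (R : realType) (a1 a2 k g u : R) :
  (phase_poly a1 a2 k g).[u] =
    u * (a1 - a2 * u + k * (u - 1)) ^+ 2 + g ^+ 2 * (u * (u - 1) ^+ 2)
    - k ^+ 2 * ((u + 1) ^+ 2 * (u - 1) ^+ 2).
Proof. by rewrite /phase_poly !hornerE. Qed.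

(* Dividing by u (u - 1)^2, the equation says that the square of the decreasing
   positive function (a1 - a2 u) / (u - 1) + k equals the increasing function
   k^2 (u + 1)^2 / u - g^2. *)
Lemma phase_poly_root_unique (R : realType) (a1 a2 k g u v : R) :
    0 < a1 -> a2 <= 0 -> 0 < k -> 1 < u -> 1 < v ->
    root (phase_poly a1 a2 k g) u -> root (phase_poly a1 a2 k g) v -> u = v.
Proof.
move=> ha1 ha2 hk; wlog uv : u v / u < v => [hw u1 v1 hu hv|].
  have [uv|vu|//] := ltgtP u v; first exact: hw.
  by apply/esym/hw.
move=> u1 v1 /rootP hu /rootP hv; exfalso; move: hu hv; rewrite !phase_polyE.
pose A t := (a1 - a2 * t) / (t - 1) + k.
have key (t : R) : 1 < t -> t * (a1 - a2 * t + k * (t - 1)) ^+ 2 + g ^+ 2 * (t * (t - 1) ^+ 2)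
    - k ^+ 2 * ((t + 1) ^+ 2 * (t - 1) ^+ 2) = 0 ->
    A t ^+ 2 + g ^+ 2 = k ^+ 2 * (t + 2 + t^-1).
  move=> t1 ht.
  have tN0 : t != 0 by apply/eqP; lra.
  have t1N0 : t - 1 != 0 by apply/eqP; lra.
  apply/eqP; rewrite -subr_eq0; apply/eqP.
  rewrite -[RHS](mul0r (t * (t - 1) ^+ 2)^-1) -ht /A; field.
  by rewrite t1N0.
move=> /(key _ u1) hu /(key _ v1) hv.
(* This form shows that [A] is positive and decreasing, since [k - a2] and [a1 - a2] are
   positive. *)
have AE (t : R) : 1 < t -> A t = k - a2 + (a1 - a2) / (t - 1).
  by move=> t1; rewrite /A; field; apply/eqP; lra.
have Av : 0 < A v.
  rewrite AE //; have : 0 < (a1 - a2) / (v - 1) by rewrite divr_gt0; lra.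
  lra.
have Auv : A v < A u.
  rewrite !AE // ltrD2l ltr_pM2l ?ltf_pV2 ?posrE; lra.
have hA : A v ^+ 2 < A u ^+ 2 by rewrite ltr_pXn2r ?nnegrE //; lra.
have : v + v^-1 <= u + u^-1.
  have := ltr_pM2l (exprn_gt0 2 hk) (v + 2 + v^-1) (u + 2 + u^-1).
  rewrite -hu -hv ltrD2r hA => /esym; lra.
rewrite leNgt => /negP; apply.
rewrite -subr_gt0; have -> : v + v^-1 - (u + u^-1) = (v - u) * (1 - (u * v)^-1).
  by field; apply/andP; split; apply/eqP; lra.
rewrite mulr_gt0 ?subr_gt0 // invf_lt1; nra.
Qed.

(* The square root on the right is the positive root of
   X^4 - B X^2 - a^2 g^2. *)
Lemma quartic_neg (R : realType) (a g B s : R) : 0 < a -> 0 < g -> 0 < s ->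
    s < Num.sqrt (1 / 2 * (Num.sqrt (4 * a ^+ 2 * g ^+ 2 + B ^+ 2) + B)) ->
    s ^+ 2 * (s ^+ 2 - B) < a ^+ 2 * g ^+ 2.
Proof.
move=> a0 g0 s0 hs.
have ag0 : 0 < a ^+ 2 * g ^+ 2 by rewrite mulr_gt0 ?exprn_gt0.
have s20 : 0 < s ^+ 2 by rewrite exprn_gt0.
have X0 : 0 < 1 / 2 * (Num.sqrt (4 * a ^+ 2 * g ^+ 2 + B ^+ 2) + B).
  by rewrite -sqrtr_gt0; lra.
move: hs; rewrite -(ltr_pXn2r (n := 2)) ?nnegrE ?sqrtr_ge0 ?(ltW s0) //.
rewrite sqr_sqrtr ?(ltW X0) // => hs.
have hs2 : 2 * s ^+ 2 - B < Num.sqrt (4 * a ^+ 2 * g ^+ 2 + B ^+ 2) by lra.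
(* If [2 * s ^+ 2 < B], the left side of the goal is already negative; otherwise [hs2] may be
   squared. *)
have [neg|pos] := ltP (2 * s ^+ 2 - B) 0.
  have : s ^+ 2 * (s ^+ 2 - B) < 0 by rewrite pmulr_rlt0 //; lra.
  lra.
move: hs2; rewrite -(ltr_pXn2r (n := 2)) ?nnegrE ?sqrtr_ge0 //.
by rewrite sqr_sqrtr; [nra | have := sqr_ge0 B; lra].
Qed.

(* The polynomial changes sign between 1 and, if k <= a1, a large explicit point;
   if k > a1, the point (k - a2) / (k - a1), where l vanishes. *)
Lemma phase_poly_root_exists (R : realType) (a1 a2 kap g : R) :
    0 < a1 -> a2 <= 0 -> 0 < kap -> 0 < g ->
    0 < a1 + a2 - kap + Num.sqrt (1 / 2 *
        (Num.sqrt (4 * (a1 - a2) ^+ 2 * g ^+ 2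
                   + ((a1 - a2) ^+ 2 - g ^+ 2 + kap ^+ 2) ^+ 2)
         + ((a1 - a2) ^+ 2 - g ^+ 2 + kap ^+ 2))) ->
  exists u, [/\ 1 < u, root (phase_poly a1 a2 (kap / 2) g) u
     & 0 < (a1 - kap / 2) * u + kap / 2 - a2].
Proof.
move=> ha1 ha2 hkap hg hf; set k := kap / 2.
have hk : 0 < k by rewrite divr_gt0.
have Q1 : 0 < (phase_poly a1 a2 k g).[1].
  rewrite phase_polyE subrr !expr0n /= !mulr0 !addr0 subr0 mul1r.
  by rewrite exprn_gt0 //; lra.
(* The intermediate value theorem on [(1, U)] gives the root; the positivity of [l] is required on
   the whole interval. *)
suff [U [U1 QU hU]] : exists U, [/\ 1 < U, (phase_poly a1 a2 k g).[U] < 0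
   & forall u, 1 < u < U -> 0 < (a1 - k) * u + k - a2].
  have [|u] := @poly_ivtoo _ (phase_poly a1 a2 k g) _ _ (ltW U1).
    by rewrite pmulr_rlt0.
  rewrite in_itv /= => uI hu; exists u; split => //; last exact: hU.
  by case/andP: uI.
have [ka|ak] := lerP k a1.
  (* For [U >= 2], [M] bounds [k - a2 + (a1 - a2) / (U - 1)]. The choice of [U] gives
     [k^2 U = 2 k^2 + M^2 + g^2], so the quadratic term in [U] absorbs [U (M^2 + g^2)]. *)
  pose M := k - a2 + (a1 - a2).
  pose U := 2 + (M ^+ 2 + g ^+ 2) / k ^+ 2.
  have U2 : 2 <= U by rewrite lerDl divr_ge0 ?addr_ge0 ?sqr_ge0.
  exists U; split; first lra.
    have -> : (phase_poly a1 a2 k g).[U] = U * ((U - 1) * (k - a2) + (a1 - a2)) ^+ 2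
       + (U - 1) ^+ 2 * (U * g ^+ 2 - k ^+ 2 * (U + 1) ^+ 2).
      by rewrite phase_polyE; ring.
    have h1 : ((U - 1) * (k - a2) + (a1 - a2)) ^+ 2 <= ((U - 1) * M) ^+ 2.
      have : 0 <= (U - 2) * (a1 - a2) by rewrite mulr_ge0; lra.
      have : 0 <= (U - 1) * (k - a2) by rewrite mulr_ge0; lra.
      by move=> *; rewrite ler_pXn2r // ?nnegrE /M; lra.
    have h2 : k ^+ 2 * U = 2 * k ^+ 2 + M ^+ 2 + g ^+ 2.
      by rewrite /U; field; apply/eqP; lra.
    have h3 : U * ((U - 1) * (k - a2) + (a1 - a2)) ^+ 2 <= U * ((U - 1) * M) ^+ 2.
      by rewrite ler_wpM2l //; lra.
    apply: (le_lt_trans (lerD h3 (lexx _))).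
    have -> : U * ((U - 1) * M) ^+ 2 + (U - 1) ^+ 2 * (U * g ^+ 2 - k ^+ 2 * (U + 1) ^+ 2)
      = (U - 1) ^+ 2 * (U * (M ^+ 2 + g ^+ 2) - (k ^+ 2 * U) * U - 2 * (k ^+ 2 * U) - k ^+ 2) by ring.
    have U1 : 0 < (U - 1) ^+ 2 by rewrite exprn_gt0 //; lra.
    rewrite pmulr_rlt0 // h2.
    have := exprn_gt0 2 hk; have := sqr_ge0 M; have := sqr_ge0 g; nra.
  by move=> u /andP[u1 _]; nra.
set d := k - a1; set e := k - a2.
have d0 : 0 < d by rewrite subr_gt0.
have e0 : 0 < e by rewrite /e; lra.
have de : d < e by rewrite /d /e; lra.
have Ed : e / d * d = e by rewrite divfK // gt_eqF.
exists (e / d); split; first by rewrite ltr_pdivlMr ?mul1r.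
  have -> : (phase_poly a1 a2 k g).[e / d] = (e - d) ^+ 2 / d ^+ 4 *
     (e * d * (d + e) ^+ 2 + g ^+ 2 * (e * d) - k ^+ 2 * (d + e) ^+ 2).
    rewrite phase_polyE; have -> : a1 = k - d by rewrite /d; ring.
    have -> : a2 = k - e by rewrite /e; ring.
    by field; rewrite gt_eqF.
  have ed0 : 0 < e - d by lra.
  rewrite pmulr_rlt0 ?divr_gt0 ?exprn_gt0 //.
  (* Put [s = d + e = kap - a1 - a2]: the hypothesis [hf] says that [s] lies below the outer square
     root. Since [4 e d = s^2 - (e - d)^2], four times the factor to be shown negative is
     [s^2 (s^2 - B) - (e - d)^2 g^2]. *)
  have := @quartic_neg R (e - d) g ((a1 - a2) ^+ 2 - g ^+ 2 + kap ^+ 2) (d + e).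
  have -> : kap = 2 * k by rewrite /k; field.
  have -> : e - d = a1 - a2 by rewrite /e /d; ring.
  have {}hf : d + e < Num.sqrt (1 / 2 * (Num.sqrt (4 * (a1 - a2) ^+ 2 * g ^+ 2
                   + ((a1 - a2) ^+ 2 - g ^+ 2 + (2 * k) ^+ 2) ^+ 2)
         + ((a1 - a2) ^+ 2 - g ^+ 2 + (2 * k) ^+ 2))).
    move: hf; rewrite (_ : kap = 2 * k); last by rewrite /k; field.
    rewrite /d /e; lra.
  move=> /(_ _ hg _ hf) H.
  have : (d + e) ^+ 2 * ((d + e) ^+ 2 - ((a1 - a2) ^+ 2 - g ^+ 2 + (2 * k) ^+ 2)) < (a1 - a2) ^+ 2 * g ^+ 2.
    by apply: H; lra.
  have -> : a1 - a2 = e - d by rewrite /e /d; ring.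
  lra.
move=> u /andP[_]; rewrite ltr_pdivlMr // /d /e; lra.
Qed.

(** * Linearization of the relative dynamics and stability of its equilibria *)

Ltac differentiate :=
  repeat first
    [ eapply is_diff_const | eapply is_diff_coord | eapply is_diff_add
    | eapply is_diff_opp | eapply is_diff_sqr | eapply is_diff_mul
    | eapply is_diff_inv
    | eapply (@is_diff_comp1 _ _ cos); first exact: is_derive_cos
    | eapply (@is_diff_comp1 _ _ sin); first exact: is_derive_sin ].

(** The [l] equation is free of [Phi] and the [Phi] equation is free of [l], whence the tridiagonal
    shape. *)
Definition relative_partials (R : realType) (a1 a2 kap l r P : R) (j : 'I_3)
    (v : 'rV[R]_3) : R :=
  [:: (2 / (r ^+ 2 - 1) * (a1 * r ^+ 2 - a2 - 2 * l * (r ^+ 2 + 1)) - kap) * v 0 0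
      + 4 * l * r * ((a1 - l) * (r ^+ 2 - 1)
           - (a1 * r ^+ 2 - a2 - l * (r ^+ 2 + 1))) / (r ^+ 2 - 1) ^+ 2 * v 0 1;
      - r * v 0 0 + (a1 - a2 - l - kap * r * cos P) * v 0 1
        + kap / 2 * sin P * (r ^+ 2 - 1) * v 0 2;
      - (kap / 2 * (1 - r ^- 2) * sin P) * v 0 1
        - kap / 2 * (r + r^-1) * cos P * v 0 2]`_j.

Lemma is_diff_relative_field (R : realType) (a1 a2 kap g : R) (x : 'rV[R]_3) j :
    x 0 1 != 0 -> x 0 1 ^+ 2 - 1 != 0 ->
  is_diff x (fun y => relative_field a1 a2 kap g y 0 j)
    (relative_partials a1 a2 kap (x 0 0) (x 0 1) (x 0 2) j).
Proof.
move=> rN0 r1N0.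
rewrite (_ : (fun y => _) = (fun y : 'rV[R]_3 =>
    [:: 2 * y 0 0 / (y 0 1 ^+ 2 - 1)
          * (a1 * y 0 1 ^+ 2 - a2 - y 0 0 * (y 0 1 ^+ 2 + 1)) - kap * y 0 0;
        (a1 - a2 - y 0 0) * y 0 1 + kap / 2 * cos (y 0 2) * (1 - y 0 1 ^+ 2);
        g - kap / 2 * (y 0 1 + (y 0 1)^-1) * sin (y 0 2)]`_j)); last first.
  by apply/funext => y; rewrite mxE.
case: j => [[|[|[|//]]] jlt] /=; rewrite /relative_partials /=.
- apply: is_diff_eq; first by differentiate.
  by apply/funext => v /=; field.
- apply: is_diff_eq; first by differentiate.
  by apply/funext => v /=; field.
- apply: is_diff_eq; first by differentiate.
  by apply/funext => v /=; field.
Qed.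

(** A row eigenvector of [jacobian] is a column eigenvector of the usual matrix of partial
    derivatives, so its coordinates satisfy the relations of [stable_eigenvector3]. *)
Lemma relative_field_stable (R : realType) (a1 a2 kap g : R) (x : 'rV[R]_3) :
    x 0 1 != 0 -> x 0 1 ^+ 2 - 1 != 0 ->
  forall p m q r n w : R,
    [/\ 0 < p, 0 < m, 0 <= n * w & - (p * m) < q * r] ->
    (forall j v, relative_partials a1 a2 kap (x 0 0) (x 0 1) (x 0 2) j v =
       [:: - p * v 0 0 + q * v 0 1; - r * v 0 0 - m * v 0 1 + n * v 0 2;
           - w * v 0 1 - m * v 0 2]`_j) ->
  linearly_stable (relative_field a1 a2 kap g) x.
Proof.
move=> rN0 r1N0 p m q r n w [p0 m0 nw0 qr] hpart z /eigenvalueP [v hv vN0].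
have hJ := jacobian_rows (fun j => @is_diff_relative_field R a1 a2 kap g x j rN0 r1N0).
have eqn j : \sum_(i < 3) v 0 i * real_complex R
    (relative_partials a1 a2 kap (x 0 0) (x 0 1) (x 0 2) j (delta_mx 0 i)) = z * v 0 j.
  have := congr1 (fun M : 'rV[R[i]]_3 => M 0 j) hv; rewrite !mxE => <-.
  by apply: eq_bigr => i _; rewrite hJ !mxE.
have := eqn 0; have := eqn 1; have := eqn 2.
rewrite !big_ord_recl !big_ord0 !hpart !mxE /=.
rewrite ?(mulr0, mulr1, addr0, add0r, subr0, sub0r, rmorph0, rmorphN, mulrN).
have E1 : lift ord0 ord0 = 1 :> 'I_3 by apply/val_inj.
have E2 : lift ord0 (lift ord0 ord0) = 2 :> 'I_3 by apply/val_inj.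
rewrite E1 E2.
rewrite (_ : ord0 = 0) // => e2 e1 e0.
apply: (@stable_eigenvector3 R p m q r n w z (v 0 0) (v 0 1) (v 0 2)) => //.
- rewrite -e0; ring.
- rewrite -e1; ring.
- rewrite -e2; ring.
- apply: contraNT vN0; rewrite !negb_or !negbK => /and3P[/eqP v0 /eqP v1 /eqP v2].
  apply/eqP/rowP => -[[|[|[|//]]] jlt]; rewrite mxE.
  + by rewrite (_ : Ordinal jlt = 0) //; apply/val_inj.
  + by rewrite (_ : Ordinal jlt = 1) //; apply/val_inj.
  + by rewrite (_ : Ordinal jlt = 2) //; apply/val_inj.
Qed.

(** The factors [2 * l / (r ^+ 2 - 1)] and [r] are invertible here; clearing them leaves equations
    linear in [l], [cos Phi] and [sin Phi] respectively. *)
Lemma relative_equilibriumP (R : realType) (a1 a2 kap g : R) (x : 'rV[R]_3) :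
    0 < x 0 0 -> 1 < x 0 1 ->
  equilibrium (relative_field a1 a2 kap g) x <->
  [/\ a1 * x 0 1 ^+ 2 - a2 - x 0 0 * (x 0 1 ^+ 2 + 1) = kap / 2 * (x 0 1 ^+ 2 - 1),
      (a1 - a2 - x 0 0) * x 0 1 = kap / 2 * cos (x 0 2) * (x 0 1 ^+ 2 - 1)
    & g * x 0 1 = kap / 2 * (x 0 1 ^+ 2 + 1) * sin (x 0 2)].
Proof.
set l := x 0 0; set r := x 0 1; set P := x 0 2 => l0 r1.
have rN0 : r != 0 by rewrite gt_eqF //; lra.
have u0 : 0 < r ^+ 2 - 1 by rewrite subr_gt0 exprn_egt1.
have uN0 : r ^+ 2 - 1 != 0 by rewrite gt_eqF.
have lN0 : l != 0 by rewrite gt_eqF.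
split=> [h|[h0 h1 h2]].
  have := congr1 (fun M : 'rV[R]_3 => M 0 0) h.
  have := congr1 (fun M : 'rV[R]_3 => M 0 1) h.
  have := congr1 (fun M : 'rV[R]_3 => M 0 2) h.
  rewrite !mxE /= -/l -/r -/P => h2 h1 h0; split.
  - apply/eqP; rewrite -subr_eq0; apply/eqP.
    rewrite -[RHS](mul0r ((r ^+ 2 - 1) / (2 * l))) -h0; field.
    by rewrite lN0.
  - lra.
  - apply/eqP; rewrite -subr_eq0; apply/eqP.
    by rewrite -[RHS](mul0r r) -h2; field.
apply/rowP => -[[|[|[|//]]] jlt]; rewrite !mxE /= -/l -/r -/P.
- by rewrite h0; field.
- by rewrite h1; ring.
- apply: (mulIf rN0); rewrite mul0r mulrBl h2; field; exact: rN0.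
Qed.

(** Eliminating [a1 - a2 - l] by the second equilibrium equation makes the last two diagonal entries
    equal to [- m], and [m > 0] because [l < a1 - a2]. The product [n * w] is a square. *)
Lemma active_equilibrium_stable (R : realType) (a1 a2 kap g : R) (x : 'rV[R]_3) :
    0 < kap -> 0 < x 0 0 < a1 - a2 -> 1 < x 0 1 ->
    equilibrium (relative_field a1 a2 kap g) x ->
  linearly_stable (relative_field a1 a2 kap g) x.
Proof.
move=> kap0 /andP[l0 la] r1 /(relative_equilibriumP _ _ _ _ l0 r1)[h0 h1 h2].
set l := x 0 0 in l0 la h0 h1 h2 *; set r := x 0 1 in r1 h0 h1 h2 *.
set c := cos _ in h1; set s := sin _ in h2.
have r0 : 0 < r by lra.
have u0 : 0 < r ^+ 2 - 1 by rewrite subr_gt0 exprn_egt1.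
have rN0 : r != 0 by rewrite gt_eqF.
have uN0 : r ^+ 2 - 1 != 0 by rewrite gt_eqF.
have u10 : 0 < r ^+ 2 + 1 by lra.
have mE : kap / 2 * c * (r + r^-1) = (a1 - a2 - l) * (r ^+ 2 + 1) / (r ^+ 2 - 1).
  have -> : a1 - a2 - l = kap / 2 * c * (r ^+ 2 - 1) / r by rewrite -h1 mulfK.
  by field; rewrite uN0.
apply: (@relative_field_stable R a1 a2 kap g x rN0 uN0
  (2 * l * (r ^+ 2 + 1) / (r ^+ 2 - 1)) (kap / 2 * c * (r + r^-1))
  (4 * l * r * (a1 - l - kap / 2) / (r ^+ 2 - 1)) r
  (kap / 2 * s * (r ^+ 2 - 1)) (kap / 2 * s * (1 - r ^- 2))).
- split.
  + by rewrite divr_gt0 // mulr_gt0 // mulr_gt0.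
  + by rewrite mE divr_gt0 // mulr_gt0 // subr_gt0.
  + have -> : kap / 2 * s * (r ^+ 2 - 1) * (kap / 2 * s * (1 - r ^- 2))
      = (kap / 2 * s * (r ^+ 2 - 1) / r) ^+ 2 by field.
    exact: sqr_ge0.
  + rewrite mE -subr_gt0.
    have -> : 4 * l * r * (a1 - l - kap / 2) / (r ^+ 2 - 1) * r -
       - (2 * l * (r ^+ 2 + 1) / (r ^+ 2 - 1) * ((a1 - a2 - l) * (r ^+ 2 + 1) / (r ^+ 2 - 1)))
      = 2 * l / (r ^+ 2 - 1) ^+ 2 * (2 * r ^+ 2 * ((a1 - l) * (r ^+ 2 - 1)
           - kap / 2 * (r ^+ 2 - 1)) + (r ^+ 2 + 1) ^+ 2 * (a1 - a2 - l)) by field.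
    (* With [kap] eliminated, [p * m + q * r] is a positive multiple of
       [2 r^2 l + (r^4 + 1) (a1 - a2 - l)]. *)
    rewrite -h0.
    have -> : 2 * r ^+ 2 * ((a1 - l) * (r ^+ 2 - 1) - (a1 * r ^+ 2 - a2 - l * (r ^+ 2 + 1)))
         + (r ^+ 2 + 1) ^+ 2 * (a1 - a2 - l)
       = 2 * r ^+ 2 * l + ((r ^+ 2) ^+ 2 + 1) * (a1 - a2 - l) by ring.
    have r20 : 0 < r ^+ 2 by rewrite exprn_gt0.
    apply: mulr_gt0; first by rewrite divr_gt0 ?mulr_gt0 ?exprn_gt0.
    apply: addr_gt0; first by rewrite !mulr_gt0.
    by rewrite mulr_gt0 ?subr_gt0 // addr_gt0 ?exprn_gt0.
- case=> [[|[|[|//]]] jlt] v; rewrite /relative_partials /= -/l -/r -/c -/s.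
  + rewrite h0.
    have -> : a1 * r ^+ 2 - a2 - 2 * l * (r ^+ 2 + 1) = kap / 2 * (r ^+ 2 - 1) - l * (r ^+ 2 + 1) by lra.
    by field.
  + have -> : a1 - a2 - l = kap / 2 * c * (r ^+ 2 - 1) / r by rewrite -h1 mulfK.
    by field.
  + by field.
Qed.

(** * Correspondence between active states and roots of [phase_poly] *)

(** Multiply the cosine equation by [u + 1] and the sine equation by [u - 1], then square and add;
    the first equilibrium equation removes [l]. *)
Lemma active_phase_poly_root (R : realType) (a1 a2 kap g : R) (x : 'rV[R]_3) :
    0 < x 0 0 -> 1 < x 0 1 ->
    equilibrium (relative_field a1 a2 kap g) x ->
  root (phase_poly a1 a2 (kap / 2) g) (x 0 1 ^+ 2).
Proof.
move=> l0 r1 /(relative_equilibriumP _ _ _ _ l0 r1)[h0 h1 h2].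
apply/rootP; rewrite phase_polyE.
have -> : a1 - a2 * x 0 1 ^+ 2 + kap / 2 * (x 0 1 ^+ 2 - 1)
  = (a1 - a2 - x 0 0) * (x 0 1 ^+ 2 + 1) by rewrite -h0; ring.
set u := x 0 1 ^+ 2 in h0 h1 h2 *.
have -> : u * ((a1 - a2 - x 0 0) * (u + 1)) ^+ 2 + g ^+ 2 * (u * (u - 1) ^+ 2)
  = ((a1 - a2 - x 0 0) * x 0 1) ^+ 2 * (u + 1) ^+ 2 + (g * x 0 1) ^+ 2 * (u - 1) ^+ 2.
  by rewrite /u; ring.
by rewrite h1 h2 !exprMn sin2cos2; ring.
Qed.

(** The unique root fixes R; the first equation then fixes [l], and the second fixes [cos Phi],
    which is injective on the given range. *)
Lemma active_state_unique (R : realType) (a1 a2 kap g : R) (x y : 'rV[R]_3) :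
    0 < a1 -> a2 <= 0 -> 0 < kap ->
    0 < x 0 0 -> 1 < x 0 1 -> 0 < x 0 2 < pi / 2 ->
    equilibrium (relative_field a1 a2 kap g) x ->
    0 < y 0 0 -> 1 < y 0 1 -> 0 < y 0 2 < pi / 2 ->
    equilibrium (relative_field a1 a2 kap g) y ->
  x = y.
Proof.
move=> a10 a20 kap0 xl xr xP xeq yl yr yP yeq.
have u1 (r : R) : 1 < r -> 1 < r ^+ 2 by move=> r1; rewrite exprn_egt1.
have Er : x 0 1 = y 0 1.
  have /eqP : x 0 1 ^+ 2 = y 0 1 ^+ 2.
    apply: (phase_poly_root_unique a10 a20 _ (u1 _ xr) (u1 _ yr)
      (active_phase_poly_root xl xr xeq) (active_phase_poly_root yl yr yeq)).
    by rewrite divr_gt0.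
  by rewrite eqrXn2 //; [move/eqP | lra | lra].
move/(relative_equilibriumP _ _ _ _ xl xr): xeq => [x0 x1 x2].
move/(relative_equilibriumP _ _ _ _ yl yr): yeq => [].
rewrite -Er => y0 y1 y2; have := u1 _ xr => v1.
have El : x 0 0 = y 0 0.
  have h : x 0 1 ^+ 2 + 1 != 0 by apply/eqP; lra.
  by apply: (mulIf h); lra.
have EP : x 0 2 = y 0 2.
  have pi0 := pi_gt0 R.
  apply: cos_inj; rewrite ?in_itv /=; [lra | lra |].
  have h : kap / 2 * (x 0 1 ^+ 2 - 1) != 0.
    by rewrite mulf_neq0 ?gt_eqF ?divr_gt0 // subr_gt0.
  by apply: (mulfI h); rewrite mulrAC -x1 El y1 mulrAC.
apply/rowP => -[[|[|[|//]]] jlt].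
- by rewrite (_ : Ordinal jlt = 0) //; apply/val_inj.
- by rewrite (_ : Ordinal jlt = 1) //; apply/val_inj.
- by rewrite (_ : Ordinal jlt = 2) //; apply/val_inj.
Qed.

Lemma cos_sin_gt0_pihalf (R : realType) (c s : R) : 0 < c -> 0 < s ->
  c ^+ 2 + s ^+ 2 = 1 -> exists P, [/\ 0 < P < pi / 2, cos P = c & sin P = s].
Proof.
move=> c0 s0 cs; have pi0 := pi_gt0 R.
have c1 : c < 1.
  by rewrite -(@ltr_pXn2r _ 2) ?nnegrE ?(ltW c0) // expr1n; have := exprn_gt0 2 s0; lra.
have cI : -1 <= c <= 1 by apply/andP; split; lra.
have cP : cos (acos c) = c by rewrite acosK // in_itv.
exists (acos c); split => //.
  apply/andP; split; first by apply: acos_gt0; apply/andP; split; lra.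
  rewrite -ltr_cos ?cos_pihalf ?cP // in_itv /=.
    by rewrite acos_ge0 // acos_lepi.
  by apply/andP; split; lra.
rewrite sin_acos // (_ : 1 - c ^+ 2 = s ^+ 2) ?sqrtr_sqr ?gtr0_norm //; lra.
Qed.

(** The cleared equilibrium equations, solved for [l], [cos Phi] and [sin Phi], define the state;
    the root equation says that the last two values lie on the unit circle. *)
Lemma active_state_exists (R : realType) (a1 a2 kap g u : R) :
    0 < a1 -> a2 <= 0 -> 0 < kap -> 0 < g -> 1 < u ->
    root (phase_poly a1 a2 (kap / 2) g) u ->
    0 < (a1 - kap / 2) * u + kap / 2 - a2 ->
  exists x : 'rV[R]_3, [/\ equilibrium (relative_field a1 a2 kap g) x,
    0 < x 0 0 < a1 - a2, 1 < x 0 1, x 0 1 ^+ 2 = u & 0 < x 0 2 < pi / 2].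
Proof.
move=> a10 a20 kap0 g0 u1 /rootP; rewrite phase_polyE => hu hl.
pose k := kap / 2; have k0 : 0 < k by rewrite divr_gt0.
pose l := ((a1 - k) * u + k - a2) / (u + 1).
pose r := Num.sqrt u.
have u10 : 0 < u - 1 by lra.
have up0 : 0 < u + 1 by lra.
have r2 : r ^+ 2 = u by rewrite sqr_sqrtr //; lra.
have r0 : 0 < r by rewrite sqrtr_gt0; lra.
have r1 : 1 < r by rewrite -(@ltr_pXn2r _ 2) ?nnegrE ?(ltW r0) // r2 expr1n.
have l0 : 0 < l by rewrite divr_gt0.
have lE : (a1 - a2 - l) * (u + 1) = a1 - a2 * u + k * (u - 1).
  by rewrite /l; field; rewrite gt_eqF.
(* This gives both the upper bound on [l] and the positivity of the prospective cosine. *)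
have la : 0 < a1 - a2 - l.
  rewrite -(pmulr_lgt0 _ up0) lE; have : 0 < k * (u - 1) by rewrite mulr_gt0.
  have : a2 * u <= 0 by rewrite mulr_le0_ge0 //; lra.
  lra.
have [|||P [hP cP sP]] := @cos_sin_gt0_pihalf R ((a1 - a2 - l) * r / (k * (u - 1)))
    (g * r / (k * (u + 1))).
- by rewrite divr_gt0 ?mulr_gt0.
- by rewrite divr_gt0 ?mulr_gt0.
- rewrite !expr_div_n ![(_ * r) ^+ 2]exprMn r2.
  have N : (k * (u - 1) * (u + 1)) ^+ 2 != 0 by rewrite gt_eqF // exprn_gt0 // !mulr_gt0.
  apply: (mulIf N); rewrite mul1r.
  have -> : ((a1 - a2 - l) ^+ 2 * u / (k * (u - 1)) ^+ 2 + g ^+ 2 * u / (k * (u + 1)) ^+ 2)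
     * (k * (u - 1) * (u + 1)) ^+ 2
     = u * ((a1 - a2 - l) * (u + 1)) ^+ 2 + g ^+ 2 * (u * (u - 1) ^+ 2).
    by field; rewrite !gt_eqF.
  rewrite lE; move: hu; rewrite -/k => /eqP; rewrite subr_eq0 => /eqP ->; ring.
pose x : 'rV[R]_3 := \row_(i < 3) [:: l; r; P]`_i.
have x0 : x 0 0 = l by rewrite mxE.
have x1 : x 0 1 = r by rewrite mxE.
have x2 : x 0 2 = P by rewrite mxE.
exists x; rewrite x0 x1 x2 r2; split => //; last by rewrite l0 -subr_gt0.
apply/relative_equilibriumP; rewrite ?x0 ?x1 ?x2 ?r2 ?cP ?sP //; split.
- by rewrite -/k /l; field; rewrite gt_eqF.
- by rewrite -/k; field; rewrite !gt_eqF.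
- by rewrite -/k; field; rewrite !gt_eqF.
Qed.

(** * Bounds on R, and recovery of the radii *)

(** When [kap < g], the bound is the larger root of [kap r^2 - 2 g r + kap]. The two roots have
    product 1, so [r > 1] cannot lie below the smaller one. *)
Lemma Rinf_minus_lt (R : realType) (kap g r : R) : 0 < kap -> 1 < r ->
  2 * (g * r) < kap * (r ^+ 2 + 1) -> Rinf_minus kap g < r.
Proof.
move=> kap0 r1 h; rewrite /Rinf_minus; case: ifP => // /negbT; rewrite -ltNge => gk.
have D : 0 <= g ^+ 2 - kap ^+ 2 by rewrite subr_ge0 ler_pXn2r ?nnegrE //; lra.
suff : Num.sqrt (g ^+ 2 - kap ^+ 2) < kap * r - g.
  move=> hs; rewrite (_ : g / kap + _ = (g + Num.sqrt (g ^+ 2 - kap ^+ 2)) / kap).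
    by rewrite ltr_pdivrMr //; lra.
  by field; rewrite gt_eqF.
have rg : 0 < kap * r - g.
  by rewrite ltNge; apply/negP => hn; nra.
rewrite -(@ltr_pXn2r _ 2) ?nnegrE ?sqrtr_ge0 ?(ltW rg) // sqr_sqrtr //.
by rewrite -subr_gt0; have : 0 < kap * (kap * (r ^+ 2 + 1) - 2 * (g * r)); [rewrite mulr_gt0 // subr_gt0|lra].
Qed.

(** The second hypothesis is the condition [l > 0]; for [kap > 2 * a1] it can be solved for
    [r ^+ 2]. *)
Lemma lt_Rinf_plus (R : realType) (a1 a2 kap r : R) : 0 < r ->
  0 < (a1 - kap / 2) * r ^+ 2 + kap / 2 - a2 -> (r%:E < Rinf_plus a1 a2 kap)%E.
Proof.
move=> r0 h; rewrite /Rinf_plus; case: ifP => [_|/negbT]; first exact: ltry.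
rewrite -ltNge => hk; rewrite lte_fin.
have d0 : 0 < kap - 2 * a1 by lra.
have hr : r ^+ 2 < (kap - 2 * a2) / (kap - 2 * a1) by rewrite ltr_pdivlMr //; lra.
rewrite -[r in r < _]gtr0_norm // -sqrtr_sqr ltr_sqrt //.
by rewrite (lt_trans _ hr) // exprn_gt0.
Qed.

Lemma active_state_radii (R : realType) (l r : R) : 0 < l -> 1 < r ->
  exists r1 r2 : R, [/\ 0 < r1, 0 < r2, l = r1 ^+ 2 - r2 ^+ 2 & r = r1 / r2].
Proof.
move=> l0 r1; have u0 : 0 < r ^+ 2 - 1 by rewrite subr_gt0 exprn_egt1.
pose s := Num.sqrt (l / (r ^+ 2 - 1)).
have s0 : 0 < s by rewrite sqrtr_gt0 divr_gt0.
have s2 : s ^+ 2 = l / (r ^+ 2 - 1) by rewrite sqr_sqrtr // ltW // divr_gt0.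
exists (r * s), s; split => //; [by rewrite mulr_gt0 //; lra | | by rewrite mulfK // gt_eqF].
by rewrite exprMn s2; field; rewrite gt_eqF.
Qed.

(** * The amplitude death state: explicit form and linearization *)

Section AmplitudeDeath.
Local Open Scope complex_scope.

(** [S + i T] is the principal square root of [(a + i g)^2 + kap^2]; the two identities compare real
    and imaginary parts of its square. [S = 0] would contradict [S * T = a * g]. *)
Lemma Yinf_plusE (R : realType) (a kap g : R) : 0 < a -> 0 < g ->
  let S : R := Num.sqrt (1 / 2 * (Num.sqrt (4 * a ^+ 2 * g ^+ 2
       + (a ^+ 2 - g ^+ 2 + kap ^+ 2) ^+ 2) + a ^+ 2 - g ^+ 2 + kap ^+ 2)) in
  exists T, [/\ S ^+ 2 - T ^+ 2 = a ^+ 2 - g ^+ 2 + kap ^+ 2, S * T = a * g, 0 < S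
    & Yinf_plus a kap g = ((a + S) / kap) +i* ((g + T) / kap)].
Proof.
move=> a0 g0 S.
set w : R[i] := (a +i* g) ^+ 2 + (kap ^+ 2)%:C.
have wE : w = (a ^+ 2 - g ^+ 2 + kap ^+ 2) +i* (2 * a * g).
  by rewrite /w expr2; simpc; congr (_ +i* _); ring.
have ReS : complex.Re (sqrtc w) = S.
  by rewrite wE /= /S; congr Num.sqrt; rewrite mul1r [RHS]mulrC !addrA;
     congr ((Num.sqrt _ + _ - _ + _) / _); ring.
have := sqr_sqrtc w; rewrite /Yinf_plus -/w.
move: ReS; case: (sqrtc w) => S' T /= -> {S'}.
rewrite wE expr2; simpc => -[h1 h2].
have ST : S * T = a * g by lra.
exists T; split => //.
- rewrite lt_neqAle sqrtr_ge0 andbT; apply/negP => /eqP S0.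
  by move: ST; rewrite -/S -S0 mul0r => /esym/eqP; rewrite gt_eqF // mulr_gt0.
- by congr (_ +i* _); rewrite mulrC.
Qed.

Lemma death_fieldE (R : realType) (a1 a2 kap g : R) (y : 'rV[R]_4) :
  death_field a1 a2 kap g y = \row_(i < 4)
    [:: (a1 + kap / 2 * (y 0 2 / (y 0 2 ^+ 2 + y 0 3 ^+ 2) - 1) - y 0 0 ^+ 2) * y 0 0;
        (a2 + kap / 2 * (y 0 2 - 1) - y 0 1 ^+ 2) * y 0 1;
        (a1 - a2 - y 0 0 ^+ 2 + y 0 1 ^+ 2) * y 0 2 - g * y 0 3
          + kap / 2 * (1 - y 0 2 ^+ 2 + y 0 3 ^+ 2);
        (a1 - a2 - y 0 0 ^+ 2 + y 0 1 ^+ 2) * y 0 3 + g * y 0 2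
          - kap * (y 0 2 * y 0 3)]`_i.
Proof.
rewrite /death_field /death_coords; apply/rowP => -[[|[|[|[|//]]]] jlt]; rewrite !mxE /=.
- by [].
- by [].
- by rewrite !expr2; simpc => /=; ring.
- by rewrite !expr2; simpc => /=; field.
Qed.

(* Differential at r1 = r2 = 0. *)
Definition death_partials (R : realType) (a1 a2 kap g X Y : R) (j : 'I_4)
    (v : 'rV[R]_4) : R :=
  [:: (a1 + kap / 2 * (X / (X ^+ 2 + Y ^+ 2) - 1)) * v 0 0;
      (a2 + kap / 2 * (X - 1)) * v 0 1;
      (a1 - a2 - kap * X) * v 0 2 + (kap * Y - g) * v 0 3;
      (g - kap * Y) * v 0 2 + (a1 - a2 - kap * X) * v 0 3]`_j.

Lemma is_diff_death_field (R : realType) (a1 a2 kap g X Y : R) j :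
    X ^+ 2 + Y ^+ 2 != 0 ->
  is_diff (death_coords 0 0 (X +i* Y)) (fun y => death_field a1 a2 kap g y 0 j)
    (death_partials a1 a2 kap g X Y j).
Proof.
move=> XY0.
have x0 : death_coords 0 0 (X +i* Y) 0 0 = 0 by rewrite mxE.
have x1 : death_coords 0 0 (X +i* Y) 0 1 = 0 by rewrite mxE.
have x2 : death_coords 0 0 (X +i* Y) 0 2 = X by rewrite mxE.
have x3 : death_coords 0 0 (X +i* Y) 0 3 = Y by rewrite mxE.
rewrite (_ : (fun y => _) = (fun y : 'rV[R]_4 =>
    [:: (a1 + kap / 2 * (y 0 2 / (y 0 2 ^+ 2 + y 0 3 ^+ 2) - 1) - y 0 0 ^+ 2) * y 0 0;
        (a2 + kap / 2 * (y 0 2 - 1) - y 0 1 ^+ 2) * y 0 1;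
        (a1 - a2 - y 0 0 ^+ 2 + y 0 1 ^+ 2) * y 0 2 - g * y 0 3
          + kap / 2 * (1 - y 0 2 ^+ 2 + y 0 3 ^+ 2);
        (a1 - a2 - y 0 0 ^+ 2 + y 0 1 ^+ 2) * y 0 3 + g * y 0 2
          - kap * (y 0 2 * y 0 3)]`_j)); last first.
  by apply/funext => y; rewrite death_fieldE mxE.
case: j => [[|[|[|[|//]]]] jlt] /=; rewrite /death_partials /=;
  (apply: is_diff_eq; [differentiate | apply/funext => v /=]); rewrite ?x0 ?x1 ?x2 ?x3 //.
- by field.
- by field.
- by field.
- by field.
Qed.

(** The Jacobian splits into the scalars [A] and [B] and a 2 x 2 block representing multiplication
    by [- (S + i T)], whose eigenvalues solve [(z + S)^2 + T^2 = 0]. *)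
Lemma death_field_stable (R : realType) (a1 a2 kap g X Y S T : R) :
    X ^+ 2 + Y ^+ 2 != 0 ->
    a1 + kap / 2 * (X / (X ^+ 2 + Y ^+ 2) - 1) < 0 ->
    a2 + kap / 2 * (X - 1) < 0 ->
    kap * X = a1 - a2 + S -> kap * Y = g + T -> 0 < S ->
  linearly_stable (death_field a1 a2 kap g) (death_coords 0 0 (X +i* Y)).
Proof.
move=> XY0; set A := a1 + _; set B := a2 + _ => A0 B0 hX hY S0 z /eigenvalueP [v hv vN0].
have hJ := jacobian_rows (fun j => @is_diff_death_field R a1 a2 kap g X Y j XY0).
have eqn j : \sum_(i < 4) v 0 i * real_complex R
    (death_partials a1 a2 kap g X Y j (delta_mx 0 i)) = z * v 0 j.
  have := congr1 (fun M : 'rV[R[i]]_4 => M 0 j) hv; rewrite !mxE => <-.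
  by apply: eq_bigr => i _; rewrite hJ !mxE.
have := eqn 0; have := eqn 1; have := eqn 2; have := eqn 3.
rewrite !big_ord_recl !big_ord0 /death_partials !mxE /= -/A -/B hX hY.
rewrite ?(mulr0, mulr1, addr0, add0r, subr0, sub0r, rmorph0, rmorphN, mulrN).
have E1 : lift ord0 ord0 = 1 :> 'I_4 by apply/val_inj.
have E2 : lift ord0 (lift ord0 ord0) = 2 :> 'I_4 by apply/val_inj.
have E3 : lift ord0 (lift ord0 (lift ord0 ord0)) = 3 :> 'I_4 by apply/val_inj.
rewrite E1 E2 E3 (_ : ord0 = 0) // => e3 e2 e1 e0.
have scal (c : R) w : c < 0 -> w != 0 -> w * c%:C = z * w -> complex.Re z < 0.
  by move=> c0 wN0; rewrite mulrC => /(mulIf wN0) <-.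
have [v0|/(scal A)] := eqVneq (v 0 0) 0; last exact.
have [v1|/(scal B)] := eqVneq (v 0 1) 0; last exact.
have hS : a1 - a2 - (a1 - a2 + S) = - S by ring.
have hT1 : g - (g + T) = - T by ring.
have hT2 : g + T - g = T by ring.
rewrite hS hT1 in e3; rewrite hS hT2 in e2.
have f2 : (z + S%:C) * v 0 2 = T%:C * v 0 3 by rewrite mulrDl -e2 rmorphN; ring.
have f3 : (z + S%:C) * v 0 3 = - T%:C * v 0 2 by rewrite mulrDl -e3 !rmorphN; ring.
pose N := (z + S%:C) ^+ 2 + T%:C ^+ 2.
have N2 : N * v 0 2 = 0 by rewrite /N mulrDl expr2 -mulrA f2 mulrCA f3; ring.
have N3 : N * v 0 3 = 0 by rewrite /N mulrDl expr2 -mulrA f3 mulrCA f2; ring.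
have /eqP : N = 0.
  apply/eqP; apply: contraNT vN0 => NN0.
  have v2 : v 0 2 = 0 by apply: (mulfI NN0); rewrite N2 mulr0.
  have v3 : v 0 3 = 0 by apply: (mulfI NN0); rewrite N3 mulr0.
  apply/eqP/rowP => -[[|[|[|[|//]]]] jlt]; rewrite mxE.
  + by rewrite (_ : Ordinal jlt = 0) //; apply/val_inj.
  + by rewrite (_ : Ordinal jlt = 1) //; apply/val_inj.
  + by rewrite (_ : Ordinal jlt = 2) //; apply/val_inj.
  + by rewrite (_ : Ordinal jlt = 3) //; apply/val_inj.
rewrite /N; case: (z) => x y /=; rewrite !expr2; simpc; rewrite eq_complex /=.
move=> /andP[/eqP hre /eqP him]; rewrite ltNge; apply/negP => x0.
(* If [x >= 0], the imaginary part [2 (x + S) y = 0] forces [y = 0], and then the real part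
   [(x + S)^2 + T^2] is positive. *)
have xS : x + S != 0 by rewrite gt_eqF //; lra.
have y0 : y = 0 by apply: (mulfI xS); rewrite mulr0; lra.
move: hre; rewrite y0; have : 0 < (x + S) * (x + S) by rewrite mulr_gt0 //; lra.
have := sqr_ge0 T; rewrite expr2; lra.
Qed.

End AmplitudeDeath.

(** * The two regimes [f > 0] and [f < 0] *)

Unset Implicit Arguments.

Theorem theorem4p7 (R : realType) (alpha1 alpha2 kappa omega1 omega2 : R)
  (halpha1 : 0 < alpha1) (halpha2 : alpha2 <= 0) (hkappa : 0 < kappa)
  (hgamma : 0 < omega1 - omega2) :
  let gamma := omega1 - omega2 in
  let a := alpha1 - alpha2 in
  let f := alpha1 + alpha2 - kappa
    + Num.sqrt (1 / 2 *
        (Num.sqrt (4 * a ^+ 2 * gamma ^+ 2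
                   + (a ^+ 2 - gamma ^+ 2 + kappa ^+ 2) ^+ 2)
         + a ^+ 2 - gamma ^+ 2 + kappa ^+ 2)) in
  (0 < f ->
     exists! x : 'rV[R]_3,
       [/\ active_phase_locked alpha1 alpha2 kappa gamma x,
           linearly_stable (relative_field alpha1 alpha2 kappa gamma) x,
           0 < x 0 0 < a,
           Rinf_minus kappa gamma < x 0 1
             /\ ((x 0 1)%:E < Rinf_plus alpha1 alpha2 kappa)%E
         & 0 < x 0 2 < pi / 2])
  /\
  (f < 0 ->
     let Y := death_coords 0 0 (Yinf_plus a kappa gamma) in
     equilibrium (death_field alpha1 alpha2 kappa gamma) Y
     /\ linearly_stable (death_field alpha1 alpha2 kappa gamma) Y).
Proof.
move=> gamma a f; have a0 : 0 < a by rewrite /a; lra.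
split=> [f0|f0 Y].
  have [||u [u1 hu hl]] := @phase_poly_root_exists R alpha1 alpha2 kappa gamma halpha1 halpha2 hkappa.
  - exact: hgamma.
  - by move: f0; rewrite /f /a !addrA.
  have [x [xeq xl xr xu xP]] := active_state_exists halpha1 halpha2 hkappa hgamma u1 hu hl.
  have /andP[l0 la] := xl.
  exists x; split; last first.
    move=> y [[yl yr _ yeq] _ _ _ yP].
    exact: (active_state_unique halpha1 halpha2 hkappa l0 xr xP xeq yl yr yP yeq).
  have /(relative_equilibriumP _ _ _ _ l0 xr)[h0 h1 h2] := xeq.
  split => //; first by split => //; exact: active_state_radii.
    exact: active_equilibrium_stable.
  split; last by apply: lt_Rinf_plus; [lra | rewrite xu].
  apply: Rinf_minus_lt => //.
  (* The lower bound on R comes from the sine equation together with the strict inequality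
     [sin Phi < 1]. *)
  have c0 : 0 < cos (x 0 2) by rewrite cos_gt0_pihalf //; have := pi_gt0 R; lra.
  have s1 : sin (x 0 2) < 1.
    rewrite lt_neqAle sin_le1 andbT; apply/eqP => s1.
    by have := cos2Dsin2 (x 0 2); rewrite s1; have := exprn_gt0 2 c0; lra.
  rewrite [gamma * _]h2 mulrA (_ : 2 * (kappa / 2 * _) = kappa * (x 0 1 ^+ 2 + 1)); last by field.
  by rewrite gtr_pMr // mulr_gt0 // addr_gt0 // exprn_gt0 //; lra.
have [T [h1 h2 S0 YE]] := @Yinf_plusE R a kappa gamma a0 hgamma.
set S : R := Num.sqrt _ in h1 h2 S0 YE.
have fE : f = alpha1 + alpha2 - kappa + S by [].
have kN0 : kappa != 0 by rewrite gt_eqF.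
pose X := (a + S) / kappa; pose Z := (gamma + T) / kappa.
have hX : kappa * X = a + S by rewrite /X mulrC divfK.
have hZ : kappa * Z = gamma + T by rewrite /Z mulrC divfK.
have X0 : 0 < X by rewrite divr_gt0 // addr_gt0.
have XZ0 : X ^+ 2 + Z ^+ 2 != 0.
  by rewrite gt_eqF // ltr_pwDl ?sqr_ge0 // exprn_gt0.
(* This is the real part of the inverse of [Yinf_plus]: taking the opposite square root gives a
   number whose product with [Yinf_plus] is -1. *)
have hinv : X / (X ^+ 2 + Z ^+ 2) = (S - a) / kappa.
  apply: (mulIf XZ0); rewrite divfK //; apply: (mulfI kN0).
  apply: (mulfI kN0); apply: (mulfI kN0).
  have -> : kappa * (kappa * (kappa * X)) = kappa ^+ 2 * (kappa * X) by ring.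
  have -> : kappa * (kappa * (kappa * ((S - a) / kappa * (X ^+ 2 + Z ^+ 2))))
    = (S - a) * ((kappa * X) ^+ 2 + (kappa * Z) ^+ 2) by field.
  rewrite hX hZ (_ : kappa ^+ 2 = S ^+ 2 - T ^+ 2 - a ^+ 2 + gamma ^+ 2); last by rewrite h1; ring.
  apply/eqP; rewrite -subr_eq0 (_ : _ - _ = 2 * (gamma + T) * (a * gamma - S * T)); last by ring.
  by rewrite h2 subrr mulr0.
rewrite /Y YE -/X -/Z; split.
  rewrite /equilibrium death_fieldE; apply/rowP => -[[|[|[|[|//]]]] jlt]; rewrite !mxE /=.
  - by rewrite mulr0.
  - by rewrite mulr0.
  (* Scaled by [kappa], the real and imaginary parts of the quadratic equation for [Yinf_plus]
     reduce to [h1] and [h2]. *)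
  - apply: (mulfI kN0); rewrite mulr0 -/a.
    transitivity (a * (kappa * X) - gamma * (kappa * Z)
      + (kappa ^+ 2 - (kappa * X) ^+ 2 + (kappa * Z) ^+ 2) / 2); first by field.
    by rewrite hX hZ; lra.
  - apply: (mulfI kN0); rewrite mulr0 -/a.
    transitivity (a * (kappa * Z) + gamma * (kappa * X) - (kappa * X) * (kappa * Z)).
      by ring.
    by rewrite hX hZ; lra.
apply: (@death_field_stable R alpha1 alpha2 kappa gamma X Z S T) => //.
(* Both radial growth rates turn out to equal [f / 2]. *)
- rewrite hinv; have -> : kappa / 2 * ((S - a) / kappa - 1) = (S - a - kappa) / 2 by field.
  by move: f0; rewrite fE /a; lra.
- by rewrite mulrBr mulr1 mulrAC hX; move: f0; rewrite fE /a; lra.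
Qed.
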